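(* Let $G$ be a graph with diameter $d\ge 2$ and chromatic number $\chi(G)$. Let $g(d,\chi(G))$ be the smallest positive integer $k$ such that \[\binom{k+d-1}{d-1}+\binom{k+d-2}{d-1}-d+1\ge \chi(G).\] Then $lmd(G)\ge g(d,\chi(G))$ and $ldim_{ms}(G)\ge g(d,\chi(G))$. Moreover, these bounds are sharp (there exist graphs for which equality holds).
   Context: All graphs are finite, connected, undirected and simple; $d(u,v)$ is the distance between $u$ and $v$, and the diameter is the maximum distance between two vertices. For a nonempty set $W\subseteq V(G)$ and a vertex $u\in V(G)$, the representation multiset $m(u|W)$ is the multiset of the distances $d(u,w)$, $w\in W$. $W$ is a local multiset resolving set of $G$ if $m(u|W)\neq m(v|W)$ for every two adjacent vertices $u,v$ of $G$; the smallest cardinality of such a set is the local multiset dimension $lmd(G)$, which is infinite if no such set exists. $W$ is a local outer multiset resolving set of $G$ if $m(u|W)\neq m(v|W)$ for every two adjacent vertices $u,v$ in $V(G)\setminus W$; the smallest cardinality of such a set is the local outer multiset dimension $ldim_{ms}(G)$. *)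

(* Defs.v *)
From mathcomp Require Import all_boot zify.
From mathcomp Require Import finmap multiset.

Set Implicit Arguments.
Unset Strict Implicit.
Unset Printing Implicit Defensive.

Local Open Scope nat_scope.
Local Open Scope mset_scope.

Record graph := Graph {
  vertex :> finType;
  adj : rel vertex;
  adj_sym : symmetric adj;
  adj_irr : irreflexive adj;
  adj_conn : forall x y : vertex, connect adj x y;
  vertex_gt0 : 0 < #|vertex|
}.

Section Invariants.
Variable G : graph.
Implicit Types (x y u v : G) (W : {set G}).

Definition walk x y (n : nat) : bool :=
  [exists p : n.-tuple G, path (@adj G) x p && (last x p == y)].

Lemma walk_exists x y : exists n, walk x y n.
Proof.
have /connectP[p p_path ->] := adj_conn x y.
by exists (size p); apply/existsP; exists (in_tuple p); rewrite p_path eqxx.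
Qed.

Definition dist x y : nat := ex_minn (walk_exists x y).

Definition diameter : nat := \max_(x : G) \max_(y : G) dist x y.

Definition colorable (k : nat) : bool :=
  [exists f : {ffun G -> 'I_k}, forall x, forall y, adj x y ==> (f x != f y)].

Lemma colorable_exists : exists k, colorable k.
Proof.
exists #|G|; apply/existsP; exists [ffun x => enum_rank x].
apply/forallP=> x; apply/forallP=> y; apply/implyP=> xy.
rewrite !ffunE (inj_eq enum_rank_inj).
by apply: contraTneq xy => ->; rewrite adj_irr.
Qed.

Definition chromatic_number : nat := ex_minn colorable_exists.

Definition repr_mset u W : {mset nat} := seq_mset [seq dist u w | w in W].

Definition local_multiset_resolving W : bool :=
  (W != set0) &&
  [forall u, forall v, adj u v ==> (repr_mset u W != repr_mset v W)].

Definition local_outer_multiset_resolving W : bool :=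
  (W != set0) &&
  [forall u in ~: W, forall v in ~: W,
     adj u v ==> (repr_mset u W != repr_mset v W)].

(* [None] stands for an infinite dimension. *)
Definition lmd : option nat :=
  if [pick W | local_multiset_resolving W] is Some W0 then
    Some #|[arg min_(W < W0 | local_multiset_resolving W) #|W|]|
  else None.

(* The whole vertex set is always a local outer multiset resolving set. *)
Lemma local_outer_exists :
  exists k, [exists W, local_outer_multiset_resolving W && (#|W| == k)].
Proof.
exists #|[set: G]|; apply/existsP; exists [set: G].
rewrite eqxx andbT; apply/andP; split.
  by rewrite -card_gt0 cardsT vertex_gt0.
by apply/forall_inP=> u; rewrite setCT inE.
Qed.

Definition ldim_ms : nat := ex_minn local_outer_exists.

End Invariants.

(* [n <= o] for [o] in the naturals extended with infinity ([None]). *)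
Definition le_inf (n : nat) (o : option nat) : bool :=
  if o is Some m then n <= m else true.

(* No subtraction truncates here when [0 < k] and [1 < d]: the first binomial
   is then at least [k + d - 1], hence at least [d]. *)
Definition g_bound (d chi k : nat) : bool :=
  (0 < k) &&
  ('C(k + d - 1, d - 1) + 'C(k + d - 2, d - 1) - d + 1 >= chi).

Lemma leq_bin_addr k d : 0 < k -> 0 < d -> k + d <= 'C(k + d, d).
Proof.
move=> k_gt0; elim: d => // -[_ _|d IHd _]; first by rewrite bin1.
have := IHd isT; have : 0 < 'C(k + d.+1, d.+2) by rewrite bin_gt0; lia.
by rewrite [k + d.+2]addnS binS; lia.
Qed.

Lemma g_exists d chi : 1 < d -> exists k, g_bound d chi k.
Proof.
move=> d_gt1; exists (maxn 1 chi); apply/andP; split; first by lia.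
have := @leq_bin_addr (maxn 1 chi) (d - 1).
have -> : maxn 1 chi + (d - 1) = maxn 1 chi + d - 1 by lia.
by move=> /(_ ltac:(lia) ltac:(lia)); lia.
Qed.

Definition g d (d_gt1 : 1 < d) (chi : nat) : nat := ex_minn (g_exists chi d_gt1).

(* Main.v *)
Require Import Defs.
From mathcomp Require Import all_boot zify.
From mathcomp Require Import finmap multiset.

Set Implicit Arguments.
Unset Strict Implicit.
Unset Printing Implicit Defensive.

Local Open Scope nat_scope.

(** Let [W] be a local outer multiset resolving set, with [k] elements, of a
    graph of diameter [d]. The representation multiset is a proper colouring
    of the vertices outside [W], and it takes its values among the
    ['C(k + d - 1, d - 1)] multisets of [k] distances in [{1, ..., d}]. Giving
    each vertex of [W] a colour of its own would add [k] colours. The term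
    [d - 1] is gained from the [d] constant multisets [{i, ..., i}] together
    with one vertex [w0] of [W]: fix [w0], and say that a vertex is central
    when it is [w0] itself or lies outside [W] at the same distance from all
    the vertices of [W]. Distances to [w0] differ by at most [1] along an edge,
    and two adjacent central vertices cannot be equally far from [w0]: neither
    would be [w0], so both would lie outside [W] with the same representation.
    So the parity of the distance to [w0] colours the central vertices
    properly, and two colours replace [d + 1] of them. Hence
    ([outer_resolving_chromatic])
    [chi <= 'C(k + d - 1, d - 1) - d + 1 + k], and
    [k <= 'C(k + d - 2, d - 1)] when [d >= 2].

    This bounds both dimensions at once, since a local multiset resolving set
    is also a local outer one. For the sharpness, the path on three vertices
    has diameter [2] and is resolved by one of its ends, and the lower bound
    is at least [1] by definition. *)

(** * Distances *)

Lemma walkP (G : graph) (x y : G) n :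
  reflect (exists p, [/\ path (@adj G) x p, last x p = y & size p = n])
          (walk x y n).
Proof.
apply: (iffP existsP) => [[p /andP[xp /eqP lp]]|[p [xp lp sp]]].
  by exists p; rewrite size_tuple.
by rewrite -sp; exists (in_tuple p); rewrite xp lp eqxx.
Qed.

Lemma dist_walk (G : graph) (x y : G) : walk x y (dist x y).
Proof. by rewrite /dist; case: ex_minnP. Qed.

Lemma dist_min (G : graph) (x y : G) n : walk x y n -> dist x y <= n.
Proof. by rewrite /dist; case: ex_minnP => m _; apply. Qed.

Lemma dist_eq0 (G : graph) (x y : G) : (dist x y == 0) = (x == y).
Proof.
apply/eqP/eqP => [d0|->].
  have := dist_walk x y; rewrite d0 => /walkP[p [_ <-]].
  by move/size0nil->.
by apply/eqP; rewrite -leqn0; apply/dist_min/walkP; exists [::].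
Qed.

Lemma distxx (G : graph) (x : G) : dist x x = 0.
Proof. by apply/eqP; rewrite dist_eq0. Qed.

Lemma adj_neq (G : graph) (x y : G) : adj x y -> x != y.
Proof. by apply: contraTneq => ->; rewrite adj_irr. Qed.

Lemma dist_eq1 (G : graph) (x y : G) : (dist x y == 1) = adj x y.
Proof.
apply/eqP/idP => [d1|xy].
  have := dist_walk x y; rewrite d1 => /walkP[p []].
  by case: p => [|z []] //=; rewrite andbT => xz <-.
apply/eqP; rewrite eqn_leq lt0n dist_eq0 adj_neq // andbT.
by apply/dist_min/walkP; exists [:: y] => /=; rewrite xy.
Qed.

Lemma dist_adj (G : graph) (u v w : G) : adj u v -> dist u w <= (dist v w).+1.
Proof.
move=> uv; have /walkP[p [vp lp sp]] := dist_walk v w.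
by apply/dist_min/walkP; exists (v :: p) => /=; rewrite uv vp lp sp.
Qed.

Lemma dist_diameter (G : graph) (x y : G) : dist x y <= diameter G.
Proof.
apply: leq_trans (leq_bigmax x); exact: (leq_bigmax (F := dist x) y).
Qed.

Lemma inl_inj (A B : Type) : injective (@inl A B).
Proof. by move=> x y []. Qed.

(** * Colourings and representations *)

Lemma chromatic_number_le (G : graph) (T : finType) (A : {set T}) (c : G -> T) :
    (forall x, c x \in A) -> (forall x y, adj x y -> c x != c y) ->
  chromatic_number G <= #|A|.
Proof.
move=> cA cP; rewrite /chromatic_number; case: ex_minnP => n _; apply.
apply/existsP; exists [ffun x => enum_rank_in (cA x) (c x)].
apply/forallP => x; apply/forallP => y; apply/implyP => /cP.
rewrite !ffunE; apply: contra_neq => /(congr1 enum_val).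
by rewrite !enum_rankK_in.
Qed.

Lemma repr_msetP (G : graph) (W : {set G}) (u v : G) :
  reflect (forall i, #|[set w in W | dist u w == i]| =
                     #|[set w in W | dist v w == i]|)
          (repr_mset u W == repr_mset v W).
Proof.
have countE x i : count_mem i [seq dist x w | w in W] =
    #|[set w in W | dist x w == i]|.
  rewrite count_map -size_filter cardE -filter_predI; congr size.
  by apply: eq_filter => w; rewrite !inE andbC.
apply: (iffP eqP) => [/eq_seq_msetP/permP uv i|uv].
  by have := uv (pred1 i); rewrite !countE.
by apply/eq_seq_msetP/allP => i _; rewrite /= !countE uv.
Qed.

Lemma repr_mset1 (G : graph) (u v w : G) :
  (repr_mset u [set w] == repr_mset v [set w]) = (dist u w == dist v w).
Proof.
rewrite /repr_mset /image_mem enum_set1 /=.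
apply/eqP/eqP => [/eq_seq_msetP|-> //].
by move/perm_mem/(_ (dist u w)); rewrite !inE eqxx => /esym/eqP.
Qed.

Lemma resolving_outer (G : graph) (W : {set G}) :
  local_multiset_resolving W -> local_outer_multiset_resolving W.
Proof.
case/andP => W0 /forallP res; rewrite /local_outer_multiset_resolving W0.
apply/forall_inP => u _; apply/forall_inP => v _.
by have /forallP/(_ v) := res u.
Qed.

(** * The bound on the chromatic number *)

Section Profiles.
Variables (G : graph) (m : nat) (W : {set G}).
Let k := #|W|.

(** A multiset of [k] distances in [{1, ..., m + 1}], encoded by its
    multiplicities: this turns the multisets into the ordered partitions of
    [k], which [card_ord_partitions] counts. *)
Definition profile (u : G) : m.+1.-tuple 'I_k.+1 :=
  [tuple inord #|[set w in W | dist u w == i.+1]| | i < m.+1].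

Definition const_profile (i : 'I_m.+1) : m.+1.-tuple 'I_k.+1 :=
  [tuple if j == i then ord_max else ord0 | j < m.+1].

Definition nonconst_profiles : {set m.+1.-tuple 'I_k.+1} :=
  [set t : m.+1.-tuple 'I_k.+1 | \sum_(i <- t) i == k]
    :\: [set const_profile i | i : 'I_m.+1].

Lemma profileE u (i : 'I_m.+1) :
  tnth (profile u) i = #|[set w in W | dist u w == i.+1]| :> nat.
Proof.
rewrite tnth_mktuple inordK // ltnS subset_leq_card //.
by apply/subsetP => w; rewrite inE => /andP[].
Qed.

Lemma card_nonconst_profiles :
  0 < k -> #|nonconst_profiles| = 'C(m + k, m) - m.+1.
Proof.
move=> k_gt0; rewrite cardsDS.
  rewrite card_ord_partitions card_imset ?card_ord // => i j /eqP.
  apply: contraTeq => ij.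
  apply/eqP => /(congr1 (fun t => val (tnth t i))).
  rewrite !tnth_mktuple eqxx (negPf ij) /= => k0.
  by rewrite k0 in k_gt0.
apply/subsetP => _ /imsetP[i _ ->]; rewrite inE big_tuple (bigD1 i) //=.
rewrite tnth_mktuple eqxx big1 ?addn0 //= => j /negPf ji.
by rewrite tnth_mktuple ji.
Qed.

Hypothesis dist_le : forall x y : G, dist x y <= m.+1.

Lemma profile_sum u : u \notin W -> \sum_(i <- profile u) i = k.
Proof.
move=> uW; rewrite big_tuple.
under eq_bigr => i _ do rewrite profileE.
have dP w : w \in W -> (inord (dist u w).-1 : 'I_m.+1).+1 = dist u w.
  move=> wW; have : 0 < dist u w.
    by rewrite lt0n dist_eq0; apply: contraNneq uW => ->.
  by have := dist_le u w; case: (dist u w) => // n lt_n _; rewrite inordK.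
transitivity (\sum_(w in W) 1); last by rewrite sum1_card.
rewrite (partition_big (fun w => inord (dist u w).-1 : 'I_m.+1) predT) //=.
apply: eq_bigr => i _; rewrite -sum1_card; apply: eq_bigl => w.
rewrite inE; case wW: (w \in W) => //=.
by rewrite -{1}(dP w wW) eqSS.
Qed.

Lemma profile_nonconst u w0 : u \notin W -> w0 \in W ->
    ~~ [forall w in W, dist u w == dist u w0] ->
  profile u \in nonconst_profiles.
Proof.
move=> uW w0W ncu; rewrite inE inE profile_sum // eqxx andbT.
apply: contra ncu => /imsetP[i _ pu]; have := profileE u i.
rewrite pu tnth_mktuple eqxx /= => Wi.
have /eqP eqW : [set w in W | dist u w == i.+1] == W.
  rewrite eqEcard -Wi leqnn andbT.
  by apply/subsetP => w; rewrite inE => /andP[].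
have dE w : w \in W -> dist u w = i.+1.
  by rewrite -eqW inE => /andP[_ /eqP].
by apply/forall_inP => w wW; rewrite !dE.
Qed.

Lemma profile_repr u v : u \notin W -> v \notin W ->
  profile u = profile v -> repr_mset u W == repr_mset v W.
Proof.
move=> uW vW puv; apply/repr_msetP => -[|i].
  have no0 x : x \notin W -> #|[set w in W | dist x w == 0]| = 0.
    move=> xW; apply: eq_card0 => w; rewrite inE dist_eq0.
    by case: eqP => [<-|_]; rewrite ?andbF // (negPf xW).
  by rewrite !no0.
have [lt_im|lt_mi] := ltnP i m.+1.
  by have := profileE u (Ordinal lt_im); rewrite puv profileE.
suff no x : #|[set w in W | dist x w == i.+1]| = 0 by rewrite !no.
apply: eq_card0 => w; rewrite inE; apply/negP => /andP[_ /eqP dxw].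
by have := dist_le x w; rewrite dxw ltnNge lt_mi.
Qed.

(** The colours are the non-constant profiles, the vertices of [W] other than
    [w0], and the two parities. A vertex of [W] needs a colour of its own
    because nothing separates it from its neighbours; [w0] is spared because
    its distance to itself, [0], continues the sequence of the constant
    multisets. *)
Lemma outer_resolving_chromatic : local_outer_multiset_resolving W ->
  chromatic_number G + m <= 'C(m + k, m) + k.
Proof.
case/andP => /set0Pn[w0 w0W] /forall_inP res.
have resW u v : u \notin W -> v \notin W -> adj u v ->
    repr_mset u W != repr_mset v W.
  rewrite -2!in_setC => uW vW uv.
  by have /forall_inP/(_ v vW)/implyP/(_ uv) := res u uW.
have k_gt0 : 0 < k by rewrite card_gt0; apply/set0Pn; exists w0.
pose central u := (u == w0) ||
  (u \notin W) && [forall w in W, dist u w == dist u w0].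
pose c u : m.+1.-tuple 'I_k.+1 + (G + bool) :=
  if central u then inr (inr (odd (dist u w0)))
  else if u \in W then inr (inl u) else inl (profile u).
pose A : {set m.+1.-tuple 'I_k.+1 + (G + bool)} :=
  [set inl t | t in nonconst_profiles] :|:
  ([set inr (inl w) | w in W :\ w0] :|: [set inr (inr b) | b : bool]).
have cA u : c u \in A.
  rewrite /c; case: ifPn => [_|]; first by rewrite !inE imset_f ?orbT.
  rewrite negb_or negb_and negbK => /andP[uw0 ncu].
  case: ifPn => uW; rewrite !inE.
    by rewrite [X in _ || (X || _)]imset_f ?orbT // !inE uw0.
  by rewrite imset_f // (profile_nonconst uW w0W) //; rewrite (negPf uW) in ncu.
have cP u v : adj u v -> c u != c v.
  move=> uv; apply/eqP; rewrite /c.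
  case: (boolP (central u)) => cu; case: (boolP (central v)) => cv.
  - case=> par.
    have vu : adj v u by rewrite adj_sym.
    have duv : dist u w0 = dist v w0.
      have := dist_adj w0 uv; have := dist_adj w0 vu; lia.
    (* Either vertex being [w0] would force the other one to be [w0] too. *)
    have uw0 : u != w0.
      apply: contraTneq uv => u0; move: duv; rewrite u0 distxx => /esym/eqP.
      by rewrite dist_eq0 => /eqP->; rewrite adj_irr.
    have vw0 : v != w0.
      by apply: contraNneq uw0 => v0; rewrite -dist_eq0 duv v0 distxx.
    move: cu cv; rewrite /central (negPf uw0) (negPf vw0) /=.
    case/andP => uW /forall_inP du /andP[vW /forall_inP dv].
    have /negP := resW u v uW vW uv; apply.
    apply/repr_msetP => i; apply: eq_card => w; rewrite !inE.
    case: (boolP (w \in W)) => //= wW.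
    by rewrite (eqP (du w wW)) (eqP (dv w wW)) duv.
  - by case: ifP.
  - by case: ifP.
  case: (boolP (u \in W)) => uW; case: (boolP (v \in W)) => vW //.
    by case=> e; move: uv; rewrite e adj_irr.
  move=> e; have /negP := resW u v uW vW uv; apply.
  exact: profile_repr uW vW (inl_inj e).
have chiA := chromatic_number_le cA cP.
have cardW : #|W :\ w0| = k.-1 by rewrite /k (cardsD1 w0 W) w0W.
have leC : m.+1 <= 'C(m + k, m).
  case: (posnP m) => [->|m_gt0]; first by rewrite bin0.
  by have := leq_bin_addr k_gt0 m_gt0; rewrite addnC; lia.
have cardA : #|A| <= #|nonconst_profiles| + (#|W :\ w0| + 2).
  apply: leq_trans (leq_card_setU _ _) _; apply: leq_add.
    exact: leq_imset_card.
  apply: leq_trans (leq_card_setU _ _) _; apply: leq_add.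
    exact: leq_imset_card.
  by apply: leq_trans (leq_imset_card _ _) _; rewrite card_bool.
have := leq_trans chiA cardA; rewrite card_nonconst_profiles // cardW.
by move: leC k_gt0; move: k (chromatic_number G) => n chi; clear; lia.
Qed.

End Profiles.

Lemma g_le (d : nat) (d_gt1 : 1 < d) chi k :
  g_bound d chi k -> g d_gt1 chi <= k.
Proof. by rewrite /g; case: ex_minnP => n _; apply. Qed.

Lemma g_gt0 (d : nat) (d_gt1 : 1 < d) chi : 0 < g d_gt1 chi.
Proof. by rewrite /g; case: ex_minnP => n /andP[]. Qed.

Lemma g_le_outer (G : graph) (d_ge2 : 2 <= diameter G) (W : {set G}) :
  local_outer_multiset_resolving W -> g d_ge2 (chromatic_number G) <= #|W|.
Proof.
move=> Wres; apply: g_le.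
have k_gt0 : 0 < #|W| by rewrite card_gt0; case/andP: Wres.
have dm : diameter G = (diameter G).-1.+1 by lia.
have dist_le (x y : G) : dist x y <= (diameter G).-1.+1.
  by rewrite -dm dist_diameter.
have := outer_resolving_chromatic dist_le Wres.
rewrite /g_bound k_gt0 /=.
move: (diameter G) (#|W|) d_ge2 k_gt0 => d k d_ge2 k_gt0 {Wres dm dist_le}.
have k_le : k <= 'C(k + d - 2, d - 1).
  have -> : k + d - 2 = k - 1 + (d - 1) by lia.
  have [k1|k_gt1] := leqP k 1.
    have -> : k = 1 by lia.
    by rewrite subnn add0n binn.
  have := @leq_bin_addr (k - 1) (d - 1); lia.
have -> : d.-1 + k = k + d - 1 by lia.
rewrite -subn1; lia.
Qed.

(** * The two dimensions *)

Lemma lmd_attained (G : graph) n : lmd G = Some n ->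
  exists2 W : {set G}, local_multiset_resolving W & #|W| = n.
Proof.
rewrite /lmd; case: pickP => // W0 W0res [<-].
by case: arg_minnP => // W Wres _; exists W.
Qed.

Lemma lmd_le (G : graph) (W : {set G}) : local_multiset_resolving W ->
  exists2 n, lmd G = Some n & n <= #|W|.
Proof.
move=> Wres; rewrite /lmd; case: pickP => [W0 W0res|/(_ W)]; last first.
  by rewrite Wres.
by eexists; first by []; case: arg_minnP => // V _; apply.
Qed.

Lemma ldim_ms_attained (G : graph) :
  exists2 W : {set G}, local_outer_multiset_resolving W & #|W| = ldim_ms G.
Proof.
rewrite /ldim_ms; case: ex_minnP => n /existsP[W /andP[Wres /eqP Wn]] _.
by exists W.
Qed.

Lemma ldim_ms_le (G : graph) (W : {set G}) :
  local_outer_multiset_resolving W -> ldim_ms G <= #|W|.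
Proof.
move=> Wres; rewrite /ldim_ms; case: ex_minnP => n _; apply.
by apply/existsP; exists W; rewrite Wres eqxx.
Qed.

Lemma g_le_lmd (G : graph) (d_ge2 : 2 <= diameter G) :
  le_inf (g d_ge2 (chromatic_number G)) (lmd G).
Proof.
case lmdE: (lmd G) => [n|//] /=; have [W Wres <-] := lmd_attained lmdE.
exact/g_le_outer/resolving_outer.
Qed.

Lemma g_le_ldim_ms (G : graph) (d_ge2 : 2 <= diameter G) :
  g d_ge2 (chromatic_number G) <= ldim_ms G.
Proof. by have [W Wres <-] := ldim_ms_attained G; apply: g_le_outer. Qed.

(** * Sharpness: the path on three vertices *)

(** The middle vertex is [None]; the two ends are [Some true] and
    [Some false]. *)
Definition path3_adj (x y : option bool) := (x == None) != (y == None).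

Lemma path3_sym : symmetric path3_adj.
Proof. by move=> x y; rewrite /path3_adj eq_sym. Qed.

Lemma path3_irr : irreflexive path3_adj.
Proof. by move=> x; rewrite /path3_adj eqxx. Qed.

Lemma path3_conn x y : connect path3_adj x y.
Proof.
apply: (@connect_trans _ _ None).
  by case: x => [b|]; rewrite ?connect0 ?connect1.
by case: y => [b|]; rewrite ?connect0 ?connect1.
Qed.

Lemma path3_gt0 : 0 < #|{: option bool}|.
Proof. by rewrite card_option. Qed.

Definition path3 : graph := Graph path3_sym path3_irr path3_conn path3_gt0.

Lemma path3_diameter : 2 <= diameter path3.
Proof.
apply: leq_trans (dist_diameter (Some true : path3) (Some false)).
rewrite ltn_neqAle lt0n dist_eq0 [1 == _]eq_sym dist_eq1.
by [].
Qed.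

(** Of two adjacent vertices one is the middle, at distance [1] from the
    chosen end, and the other is an end, at distance [0] or [2]. *)
Lemma path3_resolving :
  local_multiset_resolving [set (Some true : path3)].
Proof.
apply/andP; split; first by apply/set0Pn; exists (Some true); rewrite inE.
apply/forallP => u; apply/forallP => v; apply/implyP.
rewrite repr_mset1.
have dN : dist (None : path3) (Some true) = 1.
  by apply/eqP; rewrite dist_eq1.
have dS b : dist (Some b : path3) (Some true) != 1 by rewrite dist_eq1.
case: u => [b|]; case: v => [b'|] // _; first by rewrite dN.
by rewrite dN eq_sym.
Qed.

Theorem theorem12 :
  (forall (G : graph) (d_ge2 : 2 <= diameter G),
     le_inf (g d_ge2 (chromatic_number G)) (lmd G)
     /\ g d_ge2 (chromatic_number G) <= ldim_ms G)
  /\ (exists (G : graph) (d_ge2 : 2 <= diameter G),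
        lmd G = Some (g d_ge2 (chromatic_number G)))
  /\ (exists (G : graph) (d_ge2 : 2 <= diameter G),
        ldim_ms G = g d_ge2 (chromatic_number G)).
Proof.
split; first by move=> G d_ge2; split; [apply: g_le_lmd | apply: g_le_ldim_ms].
have g_gt0 := g_gt0 path3_diameter (chromatic_number path3).
split; exists path3, path3_diameter.
  have [n lmdE] := lmd_le path3_resolving; rewrite cards1 => n_le1.
  have := g_le_lmd path3_diameter; rewrite lmdE /= => g_le.
  by congr Some; lia.
have := ldim_ms_le (resolving_outer path3_resolving); rewrite cards1.
by have := g_le_ldim_ms path3_diameter; lia.
Qed.
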